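(* Let $\mathfrak{L}$ be a left Leibniz algebra over a field $\mathbb{F}$, and let $M$ be an irreducible weak $\mathfrak{L}$-bimodule. Then either $M$ is anti-symmetric, or $M=M\mathfrak{L}$ and $M^{\mathfrak{L}}=0$.
   Context: A left Leibniz algebra is an $\mathbb{F}$-vector space $\mathfrak{L}$ with a bilinear multiplication satisfying $x(yz)=(xy)z+y(xz)$ for all $x,y,z\in\mathfrak{L}$. A weak $\mathfrak{L}$-bimodule is an $\mathbb{F}$-vector space $M$ with bilinear left and right $\mathfrak{L}$-actions satisfying, for all $x,y\in\mathfrak{L}$, $m\in M$: (LLM) $(xy)\cdot m=x\cdot(y\cdot m)-y\cdot(x\cdot m)$ and (LML) $(x\cdot m)\cdot y=x\cdot(m\cdot y)-m\cdot(xy)$. It is irreducible if it is non-zero and has no subspaces invariant under both actions other than $0$ and itself; it is anti-symmetric if $m\cdot x=0$ for all $x\in\mathfrak{L}$, $m\in M$. Notation: $M\mathfrak{L}:=\langle m\cdot x\mid m\in M,\ x\in\mathfrak{L}\rangle_{\mathbb{F}}$ (linear span) and $M^{\mathfrak{L}}:=\{m\in M\mid m\cdot x=0\text{ for all }x\in\mathfrak{L}\}$. *)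

(* Defs.v *)
From mathcomp Require Import all_boot all_order all_algebra.
From mathcomp Require Import boolp classical_sets.
Set Implicit Arguments.
Unset Strict Implicit.
Unset Printing Implicit Defensive.
Import GRing.Theory.
Local Open Scope classical_set_scope.
Local Open Scope ring_scope.

Section Span.
Context {F : fieldType} {V : lmodType F}.

(* The ambient space may be infinite-dimensional, so the spaces of vector.v
   do not apply: subspaces are sets closed under linear combinations. *)
Definition is_subspace (N : set V) : Prop := GRing.submod_closed [in N].

Definition lin_span (S : set V) : set V :=
  [set v | exists (n : nat) (a : 'I_n -> F) (s : 'I_n -> V),
     (forall i, S (s i)) /\ v = \sum_(i < n) a i *: s i].

End Span.

Section Leibniz.
Context {F : fieldType} {L M : lmodType F}.

Definition left_leibniz (mul : {bilinear L -> L -> L}) : Prop :=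
  forall x y z, mul x (mul y z) = mul (mul x y) z + mul y (mul x z).

Variables (mul : {bilinear L -> L -> L})
  (* [lact x m] is x . m and [ract m x] is m . x *)
  (lact : {bilinear L -> M -> M}) (ract : {bilinear M -> L -> M}).

Definition LLM : Prop :=
  forall x y m, lact (mul x y) m = lact x (lact y m) - lact y (lact x m).

Definition LML : Prop :=
  forall x y m, ract (lact x m) y = lact x (ract m y) - ract m (mul x y).

Definition weak_bimodule : Prop := LLM /\ LML.

Definition invariant (N : set M) : Prop :=
  forall x m, N m -> N (lact x m) /\ N (ract m x).

Definition irreducible_bimodule : Prop :=
  (exists m : M, m != 0) /\
  forall N : set M, is_subspace N -> invariant N -> N = [set 0] \/ N = setT.

Definition anti_symmetric : Prop := forall x m, ract m x = 0.

Definition ract_span : set M :=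
  lin_span [set v | exists m x, v = ract m x].

Definition ract_annihilated : set M := [set m | forall x, ract m x = 0].

End Leibniz.

(* Main.v *)
Require Import Defs.
From mathcomp Require Import all_boot all_order all_algebra.
From mathcomp Require Import boolp classical_sets.
Local Open Scope classical_set_scope.
Local Open Scope ring_scope.

(** Both [M^L] and [ML] are sub-bimodules of [M]: by (LML),
    [(x.m).y = x.(m.y) - m.(xy)] vanishes for [m] in [M^L], and
    [x.(m.y) = (x.m).y + m.(xy)] lies in [ML].  By irreducibility each of them
    is [0] or [M], and [M^L = M] and [ML = 0] both say that [M] is
    anti-symmetric. *)

Import GRing.Theory.

Section Span.
Context {F : fieldType} {V : lmodType F}.
Implicit Types (N S : set V).

(** [submod_closed] is phrased with the boolean predicate [[in N]]; this form works directly with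
    the [Prop]-valued set [N]. *)
Lemma is_subspaceP N :
  is_subspace N <-> N 0 /\ forall a u v, N u -> N v -> N (a *: u + v).
Proof.
split=> -[N0 Nlin]; split=> [|a u v].
- by move: N0; rewrite /= in_setE.
- by move=> /mem_set Nu /mem_set Nv; apply/set_mem/Nlin.
- exact: mem_set.
- by move=> /set_mem Nu /set_mem Nv; apply/mem_set/Nlin.
Qed.

Lemma sub_lin_span S : S `<=` lin_span S.
Proof.
move=> v Sv; exists 1%N, (fun=> 1), (fun=> v); split=> //.
by rewrite big_ord1 scale1r.
Qed.

Lemma is_subspace_lin_span S : is_subspace (lin_span S).
Proof.
apply/is_subspaceP; split=> [|c u v [n [a [s [Ss ->]]]] [m [b [t [St ->]]]]].
  by exists 0%N, (fun=> 0), (fun=> 0); split=> [[]|] //; rewrite big_ord0.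
(* The two combinations are concatenated, with the scalar [c] absorbed into the coefficients of the
   first. *)
exists (n + m)%N,
  (fun i => match split i with inl j => c * a j | inr k => b k end),
  (fun i => match split i with inl j => s j | inr k => t k end).
split=> [i|]; first by case: (split i).
rewrite big_split_ord scaler_sumr /=; congr (_ + _); apply: eq_bigr => i _.
  by rewrite (unsplitK (inl i)) scalerA.
by rewrite (unsplitK (inr i)).
Qed.

Lemma lin_span_min S N : is_subspace N -> S `<=` N -> lin_span S `<=` N.
Proof.
move=> /is_subspaceP[N0 Nlin] SN v [n [a [s [Ss ->]]]].
elim/big_rec: _ => // i u _ Nu; exact/Nlin/Nu/SN/Ss.
Qed.

End Span.

(** Used with [lin_span_min] to check on generators alone that a linear map sends a whole span into
    [N]. *)
Lemma is_subspace_preimage {F : fieldType} {U V : lmodType F}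
    (f : {linear U -> V}) (N : set V) :
  is_subspace N -> is_subspace (f @^-1` N).
Proof.
move=> /is_subspaceP[N0 Nlin]; apply/is_subspaceP; split=> [|a u v Nu Nv].
  by rewrite /preimage /= linear0.
by rewrite /preimage /= linearP; apply: Nlin.
Qed.

Section WeakBimodule.
Context {F : fieldType} {L M : lmodType F}.
Variables (mul : {bilinear L -> L -> L})
  (lact : {bilinear L -> M -> M}) (ract : {bilinear M -> L -> M}).

Lemma is_subspace_ract_annihilated : is_subspace (ract_annihilated ract).
Proof.
apply/is_subspaceP; split=> [x|a u v Nu Nv x]; first by rewrite linear0l.
by rewrite linearPl Nu Nv scaler0 addr0.
Qed.

Lemma invariant_ract_annihilated :
  LML mul lact ract -> Defs.invariant lact ract (ract_annihilated ract).
Proof.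
move=> lml x m Nm; split=> y; first by rewrite lml !Nm linear0r subr0.
by rewrite Nm linear0l.
Qed.

Lemma ract_span_ract m x : ract_span ract (ract m x).
Proof. by apply: sub_lin_span; exists m, x. Qed.

Lemma invariant_ract_span :
  LML mul lact ract -> Defs.invariant lact ract (ract_span ract).
Proof.
(* Any [ract m x] is itself a generator, so only the left action needs an argument. *)
move=> lml x m Nm; split; last exact: ract_span_ract.
have Nsub : is_subspace (ract_span ract) by exact: is_subspace_lin_span.
(* By linearity of [lact x], it is enough to treat a generator [ract u y] in place of [m]. *)
apply: (lin_span_min _ _ (is_subspace_preimage (lact x) _ Nsub)) Nm.
move=> _ [u [y ->]]; rewrite /preimage /=.
(* (LML) solved for its middle term; the coefficient [1] gives the shape [a *: u + v] that [Nlin]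
   expects. *)
have -> : lact x (ract u y) = 1 *: ract (lact x u) y + ract u (mul x y).
  by rewrite scale1r lml subrK.
by have /is_subspaceP[_ Nlin] := Nsub; apply: Nlin; exact: ract_span_ract.
Qed.

End WeakBimodule.

Theorem proposition3p9 (F : fieldType) (L M : lmodType F)
    (mul : {bilinear L -> L -> L})
    (lact : {bilinear L -> M -> M}) (ract : {bilinear M -> L -> M}) :
  left_leibniz mul ->
  weak_bimodule mul lact ract ->
  irreducible_bimodule lact ract ->
  anti_symmetric ract \/
  (setT = ract_span ract /\ ract_annihilated ract = [set 0]).
Proof.
move=> _ [_ lml] [_ irr].
have [ann0|annT] := irr _ (is_subspace_ract_annihilated ract)
  (invariant_ract_annihilated _ _ _ lml); last first.
  by left=> x m; have : ract_annihilated ract m by rewrite annT.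
(* Here [ann0] already gives half of the second alternative, so a full span completes it. *)
have [span0|spanT] := irr _ (is_subspace_lin_span _)
  (invariant_ract_span _ _ _ lml); last by right.
by left=> x m; have := ract_span_ract ract m x; rewrite /ract_span span0.
Qed.
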